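(* Let $n\ge 1$. The map $$\{\alpha \mid \alpha\vDash_e n\}\to (\mathfrak S_n)_{\max}/{\approx},\qquad \alpha\mapsto \Sigma_\alpha$$ from the set of maximal compositions of $n$ to the set of $\approx$-equivalence classes of $(\mathfrak S_n)_{\max}$ is a bijection. In particular, $\{\sigma_\alpha\mid \alpha\vDash_e n\}$ is a complete set of representatives of $(\mathfrak S_n)_{\max}/{\approx}$.
   Context: $\mathfrak S_n$ is the symmetric group on $[n]=\{1,\dots,n\}$ (products are compositions of functions), with Coxeter generators $s_i=(i,i+1)$, $1\le i\le n-1$, and Coxeter length function $\ell$ (number of inversions). Relation $\approx$: for $w,w'\in\mathfrak S_n$ write $w\overset{s_i}{\to}w'$ if $w'=s_iws_i$ and $\ell(w')\le\ell(w)$. Let $\to$ be the reflexive and transitive closure of the union of the relations $\overset{s_i}{\to}$, $1\le i\le n-1$. Write $w\approx w'$ if $w\to w'$ and $w'\to w$; this is an equivalence relation, and $w\approx w'$ implies that $w,w'$ are conjugate and $\ell(w)=\ell(w')$. $(\mathfrak S_n)_{\max}$ is the set of elements of $\mathfrak S_n$ whose length is maximal in their conjugacy class; it is a union of $\approx$-classes, and $(\mathfrak S_n)_{\max}/{\approx}$ is its quotient set. A composition of $n$ is a finite sequence of positive integers with sum $n$. A composition $\alpha=(\alpha_1,\dots,\alpha_l)$ of $n$ is called maximal, written $\alpha\vDash_e n$, if there is $0\le k\le l$ such that $\alpha_i$ is even for $i\le k$, $\alpha_i$ is odd for $i>k$, and $\alpha_{k+1}\ge\alpha_{k+2}\ge\dots\ge\alpha_l$.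 Element in stair form: let $(x_1,\dots,x_n)$ be the list with $x_{2i-1}=i$ and $x_{2i}=n-i+1$. For a composition $\alpha=(\alpha_1,\dots,\alpha_l)$ of $n$, $\sigma_\alpha\in\mathfrak S_n$ is the product of the disjoint cycles $(x_{\alpha_1+\dots+\alpha_{i-1}+1},x_{\alpha_1+\dots+\alpha_{i-1}+2},\dots,x_{\alpha_1+\dots+\alpha_{i-1}+\alpha_i})$ for $i=1,\dots,l$. It is known (Geck, Kim, Pfeiffer) that $\sigma_\alpha\in(\mathfrak S_n)_{\max}$ if and only if $\alpha$ is maximal. For $\alpha\vDash_e n$, $\Sigma_\alpha\in(\mathfrak S_n)_{\max}/{\approx}$ denotes the $\approx$-equivalence class of $\sigma_\alpha$. *)

(* Defs.v *)
From mathcomp Require Import all_boot all_fingroup.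
From mathcomp Require Import boolp.

Set Implicit Arguments.
Unset Strict Implicit.
Unset Printing Implicit Defensive.

Local Open Scope group_scope.

(* The letters 1, ..., n are represented by the elements 0, ..., n - 1 of 'I_n.
   The product of 'S_n composes from left to right; this affects neither the
   conjugates s_i w s_i nor products of disjoint cycles. *)

Section Length.
Variable n : nat.
Implicit Types w : 'S_n.

Definition perm_length w : nat :=
  #|[set p : 'I_n * 'I_n | (p.1 < p.2) && (w p.2 < w p.1)]|.

(* w -> w' by s_i, for some Coxeter generator s_i = tperm i j with j = i + 1. *)
Definition cyc_step : rel 'S_n := fun w w' =>
  [exists i : 'I_n, exists j : 'I_n,
    [&& j == i.+1 :> nat, w' == tperm i j * w * tperm i j
      & perm_length w' <= perm_length w]].

Definition approx : rel 'S_n := fun w w' =>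
  connect cyc_step w w' && connect cyc_step w' w.

Definition Smax : {set 'S_n} :=
  [set w | [forall u in w ^: [set: 'S_n], perm_length u <= perm_length w]].

Definition Smax_quotient : {set {set 'S_n}} := equivalence_partition approx Smax.

End Length.

Definition is_comp (n : nat) (alpha : seq nat) : bool :=
  all (fun a => 0 < a) alpha && (sumn alpha == n).

Definition is_max_comp (n : nat) (alpha : seq nat) : bool :=
  is_comp n alpha &&
  [exists k : 'I_(size alpha).+1,
    [&& all (fun a => ~~ odd a) (take k alpha), all odd (drop k alpha)
      & sorted geq (drop k alpha)]].

Fact half_ord_subproof (n : nat) (k : 'I_n) : k./2 < n.
Proof.
by apply: leq_ltn_trans (ltn_ord k); rewrite -{2}(odd_double_half k) -addnn addnA leq_addl.
Qed.

Definition half_ord (n : nat) (k : 'I_n) : 'I_n := Ordinal (half_ord_subproof k).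

(* Both positions and letters are shifted by 1: position 2 i - 2 holds i - 1,
   and position 2 i - 1 holds n - i, which is rev_ord applied to i - 1. *)
Definition stair (n : nat) : seq 'I_n :=
  [seq if odd k then rev_ord (half_ord k) else half_ord k | k : 'I_n <- enum 'I_n].

(* The cycle (c_1, ..., c_k), for a list c without repetition. The default
   value 1 of insubd is only reached when next c is not injective. *)
Definition cycle_perm (T : finType) (c : seq T) : {perm T} :=
  insubd (1 : {perm T}) [ffun x => next c x].

Lemma cycle_permE (T : finType) (c : seq T) (x : T) :
  uniq c -> cycle_perm c x = next c x.
Proof.
move=> Uc; have injf: injectiveb [ffun y => next c y].
  by apply/injectiveP => y z; rewrite !ffunE; apply: (can_inj (prev_next Uc)).
by rewrite /cycle_perm -pvalE /insubd insubT /= ffunE.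
Qed.

(* reshape alpha cuts the stair list into consecutive blocks of lengths
   alpha_1, ..., alpha_l. *)
Definition sigma (n : nat) (alpha : seq nat) : 'S_n :=
  \prod_(c <- reshape alpha (stair n)) cycle_perm c.

Definition Sigma (n : nat) (alpha : seq nat) : {set 'S_n} :=
  [set w | approx (sigma n alpha) w].

Definition stair_reps (n : nat) : {set 'S_n} :=
  [set w | `[< exists2 alpha, is_max_comp n alpha & w = sigma n alpha >]].

(* Main.v *)
(* Swapping the letters i, i + 1 in the cycle notation of w never decreases the
   length unless both w and its inverse descend at i. Hence the cycles of any w
   can be brought, one letter at a time and without ever decreasing the length,
   to stair form: once x_1, ..., x_t are in place, the remaining letters form an
   interval having x_(t+1) as an end, and the image of x_t can be moved towards
   that end. So every w is below some sigma_alpha, alpha a composition.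

   The number of pairs of letters that sigma_alpha does not invert is the sum
   over the parts a of floor((a - 1) / 2), plus, if a is odd, the sum of the
   parts after a. Swapping two adjacent parts shows that it is minimal among
   rearrangements of alpha exactly when alpha is maximal; hence the elements of
   maximal length are those equivalent to sigma_alpha with alpha maximal.

   Finally, alpha can be recovered from the class of sigma_alpha: its multiset of
   parts is the cycle type, and the partial sums of its even parts are the 2 k
   for which the k smallest and the k largest letters are exchanged, a property
   that is invariant under length-preserving steps because any step that could
   break it strictly decreases the length. *)
Require Import Defs.
From mathcomp Require Import all_boot all_fingroup.
From mathcomp Require Import boolp classical_sets functions.
From mathcomp Require Import zify.

Set Implicit Arguments.
Unset Strict Implicit.
Unset Printing Implicit Defensive.

Local Open Scope group_scope.

(** * Length under adjacent transpositions *)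

Section AdjacentTransposition.
Variables (n : nat) (i j : 'I_n).
Hypothesis ij : j = i.+1 :> nat.
Implicit Types (w : 'S_n) (p q : 'I_n).
Local Notation s := (tperm i j).

Lemma tperm_adjE p :
  s p = (if p == i :> nat then i.+1 else if p == i.+1 :> nat then i : nat else p) :> nat.
Proof.
rewrite -ij; case: tpermP => [->|->|/eqP pi /eqP pj]; rewrite ?eqxx //.
  by case: eqP => // ->.
by rewrite -val_eqE in pi; rewrite -val_eqE in pj; rewrite (negPf pi) (negPf pj).
Qed.

Lemma tperm_adj_lt p q : p < q -> (p != i) || (q != j) -> s p < s q.
Proof. rewrite -!val_eqE /= !tperm_adjE; do !case: eqP; lia. Qed.

(** The involution [f] matches the inversions of [w] with those of [s * w] other than [(i, j)], and
    [(i, j)] is inverted by [s * w] only. *)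
Lemma perm_length_tpermL w : w i < w j -> perm_length (s * w) = (perm_length w).+1.
Proof.
move=> wij; pose f (pq : 'I_n * 'I_n) := (s pq.1, s pq.2).
have fK : involutive f by case=> p q; rewrite /f /= !tpermK.
pose I (v : 'S_n) := [set pq : 'I_n * 'I_n | (pq.1 < pq.2) && (v pq.2 < v pq.1)].
have -> : perm_length w = #|f @^-1: I w| by rewrite card_preimset //; apply: can_inj fK.
rewrite /perm_length (cardsD1 (i, j)) inE /= !permM tpermL tpermR wij ij ltnSn add1n.
congr (#|pred_of_set _|).+1; apply/setP=> -[p q]; rewrite !inE /= !permM xpair_eqE.
have [/eqP-> | Dp] := boolP (p == i); have [/eqP-> | Dq] := boolP (q == j) => //=.
- by rewrite tpermL tpermR ij; lia.
- have [->|qi] := eqVneq q i; first by rewrite !ltnn.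
  congr (_ && _); apply/idP/idP => [iq|]; first by apply: tperm_adj_lt; rewrite ?Dq ?orbT.
  rewrite !tperm_adjE eqxx; move: qi Dq; rewrite -!val_eqE /=; do !case: eqP; lia.
- have [->|pi] := eqVneq p j; first by rewrite !ltnn.
  congr (_ && _); apply/idP/idP => [iq|]; first by apply: tperm_adj_lt; rewrite ?Dp.
  rewrite !tperm_adjE; move: pi Dp; rewrite -!val_eqE /= ij eqxx; do !case: eqP; lia.
- have [/andP[/eqP-> /eqP->] |] := boolP ((p == j) && (q == i)).
    by rewrite tpermL tpermR ij; move: wij; lia.
  move=> pq; congr (_ && _); apply/idP/idP => [iq|]; first by apply: tperm_adj_lt; rewrite ?Dp.
  rewrite !tperm_adjE; move: pq Dp Dq; rewrite -!val_eqE /= ij; do !case: eqP; lia.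
Qed.

Lemma perm_lengthV w : perm_length w^-1 = perm_length w.
Proof.
pose f (pq : 'I_n * 'I_n) := (w pq.2, w pq.1).
have fI : injective f by case=> p q [p' q'] [] /perm_inj-> /perm_inj->.
rewrite /perm_length -(card_preimset _ fI); apply: eq_card => -[p q].
by rewrite !inE /= !permK andbC.
Qed.

Lemma perm_length_tpermLS w :
  w j < w i -> perm_length w = (perm_length (s * w)).+1.
Proof.
move=> wji; rewrite -[in LHS](mulKg s w) tpermV (@perm_length_tpermL (s * w)) //.
by rewrite !permM tpermL tpermR.
Qed.

Lemma perm_length_tpermR w :
  w^-1 i < w^-1 j -> perm_length (w * s) = (perm_length w).+1.
Proof.
by move=> wij; rewrite -perm_lengthV invMg tpermV perm_length_tpermL // perm_lengthV.
Qed.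

Lemma perm_length_tpermRS w :
  w^-1 j < w^-1 i -> perm_length w = (perm_length (w * s)).+1.
Proof.
move=> wij; rewrite -perm_lengthV perm_length_tpermLS //.
by rewrite -[s * _]invgK invMg invgK tpermV perm_lengthV.
Qed.

Lemma adj_perm_neq w : (w i == w j :> nat) = false.
Proof.
apply/negbTE; apply/eqP => /val_inj/perm_inj/(congr1 val)/=; rewrite ij; lia.
Qed.

(** The multiplication by [s] on the side of the ascent adds 1 to the length; the other one, done
    afterwards, changes it by 1 either way. *)
Lemma perm_length_conj_ascent w :
  (w i < w j) || (w^-1 i < w^-1 j) -> perm_length w <= perm_length (s * w * s).
Proof.
case/orP => wij.
  have := adj_perm_neq (s * w)^-1; rewrite -ltnS -(perm_length_tpermL wij).
  case: (ltngtP ((s * w)^-1%g i) ((s * w)^-1%g j)) => // lt_ij _.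
    by rewrite (perm_length_tpermR lt_ij) leqW.
  by rewrite (perm_length_tpermRS lt_ij).
have := adj_perm_neq (w * s); rewrite -mulgA -ltnS -(perm_length_tpermR wij).
case: (ltngtP ((w * s)%g i) ((w * s)%g j)) => // lt_ij _.
  by rewrite (perm_length_tpermL lt_ij) leqW.
by rewrite (perm_length_tpermLS lt_ij).
Qed.

(** The first multiplication loses 1, and so does the second unless [w] exchanges [i] and [j], in
    which case [w] commutes with [s]. *)
Lemma perm_length_conj_descent w :
    w j < w i -> w^-1 j < w^-1 i ->
  perm_length (s * w * s) < perm_length w \/ s * w * s = w.
Proof.
move=> wji; rewrite (perm_length_tpermLS wji) => wVji.
have [/andP[/eqP ei /eqP ej]|ne] := boolP ((w^-1 j == i) && (w^-1 i == j)); [right|left].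
  have {}ei : w i = j by rewrite -ei permKV.
  have {}ej : w j = i by rewrite -ej permKV.
  suff -> : s * w = w * s by rewrite -mulgA tperm2 mulg1.
  by rewrite [LHS]conjgC tpermJ ej ei tpermC.
rewrite negb_and in ne.
have /perm_length_tpermRS -> : (s * w)^-1 j < (s * w)^-1 i; last exact: leqnSn.
by rewrite invMg tpermV !permM; apply: tperm_adj_lt.
Qed.

End AdjacentTransposition.

(** * Products of disjoint cycles and the stair *)

Section CycleProduct.
Variable T : finType.
Implicit Types (c s : seq T) (cs : seq (seq T)) (x : T).

Lemma next_notin c x : x \notin c -> next c x = x.
Proof. by rewrite next_nth => /negPf->. Qed.

Lemma flatten_uniq cs c : uniq (flatten cs) -> c \in cs -> uniq c.
Proof.
elim: cs => // c' cs IH /=; rewrite cat_uniq inE => /and3P[Uc _ Ucs].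
by case/predU1P => [->//|]; apply: IH.
Qed.

Lemma cycle_prod_notin cs x :
    uniq (flatten cs) -> x \notin flatten cs ->
  (\prod_(c <- cs) cycle_perm c) x = x.
Proof.
elim: cs => [|c cs IH] /=; first by rewrite big_nil perm1.
rewrite cat_uniq mem_cat negb_or => /and3P[Uc _ Ucs] /andP[xc xcs].
by rewrite big_cons permM cycle_permE // next_notin // IH.
Qed.

Lemma cycle_prodE cs c x :
    uniq (flatten cs) -> c \in cs -> x \in c ->
  (\prod_(c <- cs) cycle_perm c) x = next c x.
Proof.
elim: cs => // c' cs IH /=.
rewrite cat_uniq inE big_cons permM => /and3P[Uc /hasPn dis Ucs] /predU1P[->|c_cs] xc.
  rewrite cycle_permE // cycle_prod_notin //; apply/negP => /dis/negP.
  by rewrite mem_next.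
rewrite cycle_permE // next_notin ?IH //; apply: dis.
by apply/flattenP; exists c.
Qed.

Lemma eq_cycle_prod cs cs' :
    uniq (flatten cs) -> perm_eq cs cs' ->
  \prod_(c <- cs) cycle_perm c = \prod_(c <- cs') cycle_perm c.
Proof.
move=> Ucs eq_cs; have eq_flat := perm_flatten eq_cs.
have Ucs' : uniq (flatten cs') by rewrite -(perm_uniq eq_flat).
apply/permP => x; have [/flattenP[c c_cs xc] | x_cs] := boolP (x \in flatten cs).
  by rewrite !(@cycle_prodE _ c) // -(perm_mem eq_cs).
by rewrite !cycle_prod_notin // -(perm_mem eq_flat).
Qed.

Lemma cycle_prodJ cs (g : {perm T}) :
    uniq (flatten cs) ->
  (\prod_(c <- cs) cycle_perm c) ^ g = \prod_(c <- map (map g) cs) cycle_perm c.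
Proof.
move=> Ucs; have Ugcs : uniq (flatten (map (map g) cs)).
  by rewrite -map_flatten map_inj_uniq //; apply: perm_inj.
apply/permP => x; rewrite -(permKV g x) permJ; set y := g^-1 x.
have [/flattenP[c c_cs yc] | y_cs] := boolP (y \in flatten cs).
  rewrite (@cycle_prodE cs c) // (@cycle_prodE _ (map g c)) ?map_f //.
  by rewrite next_map ?(flatten_uniq Ucs) //; apply: perm_inj.
rewrite !cycle_prod_notin // -map_flatten mem_map //; exact: perm_inj.
Qed.

End CycleProduct.

Section Stair.
Variable n : nat.

Lemma size_stair : size (stair n.+1) = n.+1.
Proof. by rewrite size_map -cardE card_ord. Qed.

Definition stair_letter (k : nat) : 'I_n.+1 := nth ord0 (stair n.+1) k.
Local Notation X := stair_letter.

Lemma stair_letterE k :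
  k <= n -> X k = (if odd k then n - k./2 else k./2) :> nat.
Proof.
rewrite -ltnS => lt_kn; rewrite /X (nth_map ord0) -?cardE ?card_ord //.
set q := nth _ _ _; have <- : q = k :> nat by rewrite nth_enum_ord.
by case: (odd q); rewrite /= ?subSS.
Qed.

(** An even position takes the smallest letter still free and an odd one the largest, so the parity
    of the earlier position decides every comparison. *)
Lemma stair_letter_lt j k : j < k <= n -> (X j < X k) = ~~ odd j.
Proof.
case/andP=> jk kn; rewrite !stair_letterE ?(leq_trans (ltnW jk)) //.
case: ifP; case: ifP; lia.
Qed.

Lemma stair_letter_gt j k : j < k <= n -> (X k < X j) = odd j.
Proof.
case/andP=> jk kn; rewrite !stair_letterE ?(leq_trans (ltnW jk)) //.
case: ifP; case: ifP; lia.
Qed.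

Lemma stair_letter_inj j k : j <= n -> k <= n -> X j = X k -> j = k.
Proof.
move=> jn kn eqX; case: (ltngtP j k) => // lt.
  have := @stair_letter_lt j k; have := @stair_letter_gt j k.
  by rewrite lt kn eqX ltnn => <- // /(_ isT).
have := @stair_letter_lt k j; have := @stair_letter_gt k j.
by rewrite lt jn eqX ltnn => <- // /(_ isT).
Qed.

Lemma stair_uniq : uniq (stair n.+1).
Proof.
apply/(uniqP ord0) => j k; rewrite !inE size_stair !ltnS; exact: stair_letter_inj.
Qed.

Lemma mem_stair p : p \in stair n.+1.
Proof.
suff [_ ->] : (size (stair n.+1) = size (enum 'I_n.+1)) * (stair n.+1 =i enum 'I_n.+1).
  by rewrite mem_enum.
have [||? ?] := uniq_min_size stair_uniq (s2 := enum 'I_n.+1).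
- by move=> q; rewrite mem_enum.
- by rewrite size_stair -cardE card_ord.
- by split.
Qed.

Lemma stair_letterP p : {k | k <= n & p = X k}.
Proof.
exists (index p (stair n.+1)); last by rewrite /X nth_index // mem_stair.
by have := mem_stair p; rewrite -index_mem size_stair ltnS.
Qed.

End Stair.

(* The permutation of positions induced by cycles on consecutive blocks of
   lengths alpha; positions after the last block are sent to their successor,
   as in a block that is not yet closed. *)
Fixpoint block_cycle (alpha : seq nat) (j : nat) : nat :=
  if alpha is a :: alpha' then
    if j < a then if j.+1 == a then 0 else j.+1
    else a + block_cycle alpha' (j - a)
  else j.+1.

Lemma cycle_prod_reshape (T : finType) (x0 : T) alpha (s : seq T) j :
    uniq s -> sumn alpha = size s -> j < size s ->
  (\prod_(c <- reshape alpha s) cycle_perm c) (nth x0 s j)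
    = nth x0 s (block_cycle alpha j).
Proof.
elim: alpha s j => [|a alpha IH] s j Us /=; first by move <-.
move=> size_s lt_js; rewrite big_cons permM.
have size_t : size (take a s) = a by rewrite size_take; case: ltnP; lia.
have size_d : sumn alpha = size (drop a s) by rewrite size_drop; lia.
have Ut := take_uniq a Us; have Ud := drop_uniq a Us.
have dis : {in take a s, forall x, x \notin drop a s}.
  move: Us; rewrite -{1}(cat_take_drop a s) cat_uniq => /and3P[_ /hasPn disj _] x xt.
  by apply: contraL xt => /disj.
have flatK : flatten (reshape alpha (drop a s)) = drop a s by rewrite reshapeKr ?size_d.
have [lt_ja|le_aj] := ltnP j a; last first.
  have xd : nth x0 s j = nth x0 (drop a s) (j - a) by rewrite nth_drop subnKC.
  rewrite cycle_permE // next_notin; first by rewrite xd IH ?nth_drop //; lia.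
  by apply/negP => /dis; rewrite xd mem_nth // -size_d; lia.
have xt : nth x0 s j = nth x0 (take a s) j by rewrite nth_take.
rewrite cycle_permE // xt next_nth mem_nth ?size_t // index_uniq ?size_t //.
(* [next] sends position [j] of the block to [nth y p j]; at the last position the default [y]
   closes the cycle. *)
case Et : (take a s) size_t xt => [|y p] /= size_t xt; first by lia.
rewrite cycle_prod_notin ?flatK //; last first.
  apply: dis; rewrite Et; case: (ltnP j (size p)) => jp; last by rewrite nth_default ?mem_head.
  by rewrite inE mem_nth ?orbT.
case: eqP => [ja|ja].
  by rewrite nth_default -1?(nth_take x0 (n0 := a)) ?Et //; lia.
rewrite -[in RHS](nth_take x0 (n0 := a)) ?Et /=; last by lia.
by apply: set_nth_default; lia.
Qed.

Lemma sigmaE n alpha j : sumn alpha = n.+1 -> j <= n ->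
  sigma n.+1 alpha (stair_letter n j) = stair_letter n (block_cycle alpha j).
Proof.
move=> sum_alpha le_jn.
by rewrite /sigma /stair_letter cycle_prod_reshape ?stair_uniq ?size_stair.
Qed.

Lemma block_cycle_ge alpha j : sumn alpha <= j -> block_cycle alpha j = j.+1.
Proof.
elim: alpha j => //= a alpha IH j le_j; rewrite ltnNge IH; last by lia.
by case: leqP => /=; lia.
Qed.

Lemma block_cycle_lt alpha j : j < sumn alpha -> block_cycle alpha j < sumn alpha.
Proof.
elim: alpha j => //= a alpha IH j; case: (ltnP j a) => [lt_ja|le_aj] lt_j.
  by case: eqP; lia.
by rewrite ltn_add2l IH //; lia.
Qed.

Lemma block_cycle_surj alpha m :
  m < sumn alpha -> exists2 j, j < sumn alpha & block_cycle alpha j = m.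
Proof.
elim: alpha m => //= a alpha IH m lt_m; have [lt_ma|le_am] := ltnP m a.
  case: m lt_ma lt_m => [|m] lt_ma lt_m; [exists a.-1 | exists m]; try by lia.
    by rewrite prednK // leqnn eqxx.
  by rewrite (ltnW lt_ma) ltn_eqF.
have [|j lt_j jm] := IH (m - a); first by lia.
exists (a + j); first by lia.
by rewrite ltnNge leq_addr addKn jm subnKC.
Qed.

(** Closing an open block alters only its last position: the earlier ones already go to their
    successors. *)
Lemma block_cycle_rcons alpha a j : j <= sumn alpha + a ->
  block_cycle (rcons alpha a.+1) j
    = if j == sumn alpha + a then sumn alpha else block_cycle alpha j.
Proof.
elim: alpha j => /= [|b alpha IH] j; first by rewrite add0n ltnS eqSS => ->.
move=> le_j; case: ltnP => [lt_jb|le_bj].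
  by have [eq_j|//] := eqVneq j (b + _ + _); lia.
rewrite IH; last by lia.
have -> : (j - b == sumn alpha + a) = (j == b + sumn alpha + a).
  by apply/eqP/eqP; lia.
by case: ifP.
Qed.

(** The step leads from the conjugate down to [w]; bringing [w] to stair form thus builds a path
    that ends in [w]. *)
Lemma cyc_step_ascent n (w : 'S_n) (i j : 'I_n) :
    j = i.+1 :> nat -> (w i < w j) || (w^-1 i < w^-1 j) ->
  cyc_step (tperm i j * w * tperm i j) w.
Proof.
move=> ij asc; apply/existsP; exists i; apply/existsP; exists j.
rewrite ij eqxx perm_length_conj_ascent // andbT -!mulgA tperm2 mulg1 mulgA.
by rewrite tperm2 mul1g eqxx.
Qed.

(** * Reaching the stair form *)

Section StairForm.
Variable n : nat.
Local Notation X := (stair_letter n).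
Implicit Types (w : 'S_n.+1) (alpha : seq nat).

(** [alpha] lists the closed cycles only. When [sumn alpha <= t], the positions from [sumn alpha] to
    [t] form a cycle still open, with [X t] as its last letter so far. *)
Definition in_stair_form_upto t alpha w :=
  forall j, j < t -> w (X j) = X (block_cycle alpha j).

(** By injectivity of [w]: the images of the positions below [t] already fill all positions up to
    [t] except [sumn alpha], where the open cycle starts. *)
Lemma stair_form_next t alpha w m :
    sumn alpha <= t <= n -> in_stair_form_upto t alpha w ->
    m <= n -> w (X t) = X m -> m = sumn alpha \/ t < m.
Proof.
case/andP=> le_at le_tn formw le_mn wt.
case: (ltngtP m (sumn alpha)) => [lt_ma|lt_am|]; last 1 first.
- by left.
- have [j lt_ja jm] := block_cycle_surj lt_ma.
  have := formw j (leq_trans lt_ja le_at); rewrite jm -wt => /perm_inj/stair_letter_inj; lia.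
case: (ltnP t m) => [|le_mt]; [by right | exfalso].
case: m => // m in le_mn wt lt_am le_mt *.
have := formw m le_mt; rewrite block_cycle_ge // -wt => /perm_inj/stair_letter_inj; lia.
Qed.

Lemma stair_form_conj t alpha w (i j : 'I_n.+1) :
    sumn alpha <= t <= n -> in_stair_form_upto t alpha w ->
    (forall k, k <= t -> (X k != i) && (X k != j)) ->
  in_stair_form_upto t alpha (tperm i j * w * tperm i j).
Proof.
case/andP=> le_at le_tn formw fixX.
have sX k : k <= t -> tperm i j (X k) = X k.
  by case/fixX/andP=> ki kj; rewrite tpermD // eq_sym.
move=> k lt_kt; rewrite !permM sX 1?ltnW // formw // sX //.
case: (ltnP k (sumn alpha)) => [/block_cycle_lt|/block_cycle_ge ->//]; lia.
Qed.

Lemma stair_form_preimage t alpha w m :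
    sumn alpha <= t <= n -> in_stair_form_upto t alpha w ->
    t < m <= n -> w (X t) != X m -> exists2 q, t < q <= n & w^-1 (X m) = X q.
Proof.
case/andP=> le_at le_tn formw /andP[lt_tm le_mn] wt.
have [q le_qn wq] := stair_letterP (w^-1 (X m)); exists q => //; rewrite le_qn andbT.
have {}wq : w (X q) = X m by rewrite -wq permKV.
case: (ltngtP t q) => // [lt_qt | eq_tq]; last by rewrite eq_tq wq eqxx in wt.
have le_bt : block_cycle alpha q <= t.
  by case: (ltnP q (sumn alpha)) => [/block_cycle_lt|/block_cycle_ge ->//]; lia.
by have := formw q lt_qt; rewrite wq => /stair_letter_inj; lia.
Qed.

Local Notation dist a b := ((a - b) + (b - a))%N.

(* The letters beyond position t form an interval with end X t.+1; shifting
   w (X t) by one towards that end is never a length-decreasing step, because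
   X t is the other extreme of the letters from position t on. *)
Lemma stair_form_step t alpha w m :
    sumn alpha <= t <= n -> in_stair_form_upto t alpha w ->
    t.+1 < m <= n -> w (X t) = X m ->
  exists w' m', [/\ cyc_step w' w, in_stair_form_upto t alpha w', t < m' <= n,
     w' (X t) = X m' & dist (X m') (X t.+1) < dist (X m) (X t.+1)].
Proof.
move=> at_n formw /andP[lt_tm le_mn] wt; have /andP[_ le_tn] := at_n.
have lt1n : t < t.+1 <= n by lia.
have tm_n : t < m <= n by lia.
have wVm : w^-1 (X m) = X t by rewrite -wt permK.
have fixX m' : t < m' <= n -> forall k, k <= t -> X k != X m'.
  case/andP=> ? ? k le_kt; apply/eqP => /stair_letter_inj; lia.
have := @stair_letter_lt n t.+1 m; have := @stair_letter_gt n t.+1 m.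
rewrite lt_tm le_mn /= negbK => /(_ isT) gt_m /(_ isT) lt_m.
(* For odd [t] the end [X t.+1] is the lowest remaining letter and the image moves down by one; for
   even [t] it moves up. *)
have [odd_t | even_t] := boolP (odd t).
  rewrite odd_t in lt_m.
  have lt_i : (X m).-1 < n.+1 by apply: leq_ltn_trans (leq_pred _) (ltn_ord _).
  have [m' le_m'n im'] := stair_letterP (Ordinal lt_i).
  have {im'} m'E : X m = (X m').+1 :> nat by rewrite -im' prednK //; apply: leq_ltn_trans lt_m.
  (* A letter at a position up to [t] lies on one side of all letters beyond [t], whereas [X m'] is
     at least [X t.+1] and below [X m]. *)
  have lt_tm' : t < m'.
    rewrite ltnNge; apply/negP => le_m't.
    have := @stair_letter_lt n m' t.+1; have := @stair_letter_gt n m' m.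
    case: (odd m'); rewrite ltnS le_m't le_mn ?(leq_ltn_trans le_m't) /= ?(ltnW lt_tm) //;
      lia.
  have m'n : t < m' <= n by rewrite lt_tm'.
  have wt' : w (X t) != X m' by rewrite wt -val_eqE /=; lia.
  have [q /andP[lt_tq le_qn] wq] := stair_form_preimage at_n formw m'n wt'.
  exists (tperm (X m') (X m) * w * tperm (X m') (X m)), m'; split => //.
  - apply: cyc_step_ascent => //; apply/orP; right.
    by rewrite wVm wq stair_letter_gt ?odd_t // lt_tq.
  - by apply: stair_form_conj => // k le_k; rewrite !fixX.
  - by rewrite !permM (tpermD (z := X t)) ?wt ?tpermR 1?eq_sym ?fixX.
  - lia.
rewrite (negPf even_t) /= in gt_m.
have lt_i : (X m).+1 < n.+1 by apply: leq_ltn_trans gt_m (ltn_ord _).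
have [m' le_m'n im'] := stair_letterP (Ordinal lt_i).
have {im'} m'E : X m' = (X m).+1 :> nat by rewrite -im'.
have lt_tm' : t < m'.
  rewrite ltnNge; apply/negP => le_m't.
  have := @stair_letter_gt n m' t.+1; have := @stair_letter_lt n m' m.
  case: (odd m'); rewrite ltnS le_m't le_mn ?(leq_ltn_trans le_m't) /= ?(ltnW lt_tm) //;
    lia.
have m'n : t < m' <= n by rewrite lt_tm'.
have wt' : w (X t) != X m' by rewrite wt -val_eqE /=; lia.
have [q /andP[lt_tq le_qn] wq] := stair_form_preimage at_n formw m'n wt'.
exists (tperm (X m) (X m') * w * tperm (X m) (X m')), m'; split => //.
- apply: cyc_step_ascent => //; apply/orP; right.
  by rewrite wVm wq stair_letter_lt ?even_t // lt_tq.
- by apply: stair_form_conj => // k le_k; rewrite !fixX.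
- by rewrite !permM (tpermD (z := X t)) ?wt ?tpermL 1?eq_sym ?fixX.
- lia.
Qed.

Lemma stair_form_reach t alpha w m :
    sumn alpha <= t <= n -> in_stair_form_upto t alpha w ->
    t < m <= n -> w (X t) = X m ->
  exists2 w', connect (@cyc_step n.+1) w' w & in_stair_form_upto t.+1 alpha w'.
Proof.
move=> at_n; have [d] := ubnP (dist (X m) (X t.+1)).
elim: d => // d IH in w m * => le_d formw tm_n wt.
have [em | nem] := eqVneq m t.+1.
  exists w => // k; rewrite ltnS leq_eqVlt => /predU1P[->|]; last exact: formw.
  by rewrite wt em block_cycle_ge //; case/andP: at_n.
have tm1 : t.+1 < m <= n by lia.
have [w' [m' [step formw' m'n wt' lt_d]]] := stair_form_step at_n formw tm1 wt.
have [w'' con formw''] := IH w' m' (leq_trans lt_d le_d) formw' m'n wt'.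
by exists w'' => //; apply: connect_trans con (connect1 step).
Qed.

Lemma stair_form_close t alpha w :
    sumn alpha <= t -> in_stair_form_upto t alpha w -> w (X t) = X (sumn alpha) ->
  in_stair_form_upto t.+1 (rcons alpha (t - sumn alpha).+1) w.
Proof.
move=> le_at formw wt k; rewrite ltnS => le_kt.
rewrite block_cycle_rcons subnKC // ; have [->//|ne_kt] := eqVneq k t.
by apply: formw; rewrite ltn_neqAle ne_kt.
Qed.

Lemma stair_form_sigma alpha w :
  sumn alpha = n.+1 -> in_stair_form_upto n.+1 alpha w -> w = sigma n.+1 alpha.
Proof.
move=> sum_a formw; apply/permP => p; have [k le_kn ->] := stair_letterP p.
by rewrite formw // sigmaE.
Qed.

(** Each round settles position [t]: either its image is the start of the open cycle, which is then
    closed, or the image can be brought to [X t.+1]. For [t = n] only closing is possible, and it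
    completes the last cycle. *)
Lemma stair_form_extend t alpha w :
    sumn alpha <= t <= n -> all (leq 1) alpha -> in_stair_form_upto t alpha w ->
  exists2 beta, is_comp n.+1 beta & connect (@cyc_step n.+1) (sigma n.+1 beta) w.
Proof.
have [d] := ubnP (n - t); elim: d => // d IH in t alpha w *.
rewrite ltnS => le_d at_n pos_a formw; have /andP[le_at le_tn] := at_n.
have [m le_mn wt] := stair_letterP (w (X t)).
case: (stair_form_next at_n formw le_mn wt) => [em | lt_tm]; last first.
  have tmn : t < m <= n by rewrite lt_tm.
  have [w' con formw'] := stair_form_reach at_n formw tmn wt.
  have [||beta comp_b con_b] := IH t.+1 alpha w' _ _ pos_a formw'; try by lia.
  by exists beta => //; apply: connect_trans con_b con.
rewrite em in wt; have formw' := stair_form_close le_at formw wt.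
set beta := rcons _ _ in formw'.
have sum_b : sumn beta = t.+1 by rewrite sumn_rcons addnS subnKC.
have [et | net] := eqVneq t n.
  exists beta; first by rewrite /is_comp sum_b et eqxx all_rcons andbT.
  by rewrite et in sum_b formw'; rewrite (stair_form_sigma sum_b formw').
have [|||gamma comp_g con_g] := IH t.+1 beta w _ _ _ formw'; try by lia.
  by rewrite all_rcons.
by exists gamma.
Qed.

Lemma connect_sigma w :
  exists2 beta, is_comp n.+1 beta & connect (@cyc_step n.+1) (sigma n.+1 beta) w.
Proof. exact: (@stair_form_extend 0 [::] w). Qed.

End StairForm.

(** * The length of an element in stair form *)

Section LengthOfSigma.

(** A sum over increasing pairs does not survive a reindexing that breaks the order; its double, a
    sum over the full square, does. *)
Lemma sum_sym_double N (F : 'I_N -> 'I_N -> nat) :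
    (forall p q, F p q = F q p) -> (forall p, F p p = 0%N) ->
  (\sum_p \sum_q F p q)%N = (\sum_(p < N) \sum_(q < N | q < p) F p q)%N.*2.
Proof.
move=> Fsym F0.
have swap : (\sum_(p < N) \sum_(q < N | q < p) F p q
    = \sum_(p < N) \sum_(q < N | p < q) F p q)%N.
  rewrite (exchange_big_dep xpredT) //=; apply: eq_bigr => p _.
  by apply: eq_bigr => q _; rewrite Fsym.
rewrite -addnn [X in (_ + X)%N]swap -big_split /=.
apply: eq_bigr => p _; rewrite (bigID (fun q : 'I_N => q < p)) /=; congr (_ + _)%N.
rewrite (bigID (fun q : 'I_N => p < q)) /= [X in (_ + X)%N]big1 ?addn0; last first.
  by move=> q; rewrite -!leqNgt -eqn_leq => /eqP/val_inj->.
by apply: eq_bigl => q; case: ltngtP.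
Qed.

(* Whether the letter at position j precedes the letter at position k, for
   j != k. *)
Definition stair_lt (j k : nat) : bool := if j < k then ~~ odd j else odd k.

Lemma stair_letter_ltE n j k : j <= n -> k <= n -> j != k ->
  (stair_letter n j < stair_letter n k) = stair_lt j k.
Proof.
rewrite /stair_lt => le_jn le_kn; case: (ltngtP j k) => // lt_jk _.
  by rewrite stair_letter_lt ?lt_jk.
by rewrite stair_letter_gt ?lt_jk.
Qed.

(** The number of pairs that [sigma_alpha] does not invert, counted by positions so that recursion
    on [alpha] is possible. *)
Definition stair_ascents (alpha : seq nat) : nat :=
  \sum_(k < sumn alpha) \sum_(j < k)
    (stair_lt j k == stair_lt (block_cycle alpha j) (block_cycle alpha k)).

Lemma perm_length_stair n (w : 'S_n.+1) :
  perm_length w = \sum_(k < n.+1) \sum_(j < n.+1 | j < k)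
    ((stair_letter n j < stair_letter n k)
       != (w (stair_letter n j) < w (stair_letter n k))).
Proof.
(* [F] states inversion as a symmetric condition, so that pairs may be listed in stair order. *)
pose F (p q : 'I_n.+1) : nat := (p != q) && ((p < q) != (w p < w q)).
have Fsym p q : F p q = F q p.
  rewrite /F eq_sym; have [//|ne_qp /=] := eqVneq q p.
  have: w p != w q by rewrite (inj_eq perm_inj) eq_sym.
  by move: ne_qp; rewrite -!val_eqE /=; case: (ltngtP q p); case: (ltngtP (w p) (w q)).
have F0 p : F p p = 0%N by rewrite /F eqxx.
pose f (k : 'I_n.+1) := stair_letter n k.
have fI : injective f.
  by move=> j k /stair_letter_inj eq_jk; apply/val_inj/eq_jk; rewrite -ltnS.
apply: double_inj; transitivity (\sum_p \sum_q F p q)%N.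
  rewrite sum_sym_double //; congr _.*2.
  transitivity (\sum_(p < n.+1) \sum_(q < n.+1) ((p < q) && (w q < w p)))%N.
    rewrite /perm_length -sum1dep_card pair_bigA big_mkcond /=.
    by apply: eq_bigr => -[p q] _ /=; case: ifP.
  rewrite exchange_big; apply: eq_bigr => q _; rewrite [RHS]big_mkcond.
  apply: eq_bigr => p _ /=; case: ifP => //= lt_pq.
  rewrite Fsym /F lt_pq -val_eqE ltn_eqF //=; congr nat_of_bool.
  have: w p != w q by rewrite (inj_eq perm_inj) -val_eqE ltn_eqF.
  by rewrite -val_eqE /=; case: ltngtP.
rewrite (reindex_inj fI) /=; under eq_bigr => p _ do rewrite (reindex_inj fI) /=.
rewrite (sum_sym_double (F := fun j k => F (f j) (f k))) //; congr _.*2.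
apply: eq_bigr => k _; apply: eq_bigr => j lt_jk.
by rewrite Fsym /F (inj_eq fI) -val_eqE ltn_eqF.
Qed.

(** Each pair is either inverted or counted by [stair_ascents]. The total is independent of [alpha],
    so a longest element is one with fewest ascents. *)
Lemma perm_length_sigma n alpha : sumn alpha = n.+1 ->
  perm_length (sigma n.+1 alpha) + stair_ascents alpha
    = \sum_(k < n.+1) \sum_(j < n.+1 | j < k) 1.
Proof.
move=> sum_a; rewrite perm_length_stair /stair_ascents sum_a -big_split /=.
apply: eq_bigr => k _.
rewrite (big_ord_widen n.+1 (fun j => nat_of_bool (stair_lt j k
  == stair_lt (block_cycle alpha j) (block_cycle alpha k)))) 1?ltnW // -big_split /=.
apply: eq_bigr => j lt_jk.
have le_n (i : 'I_n.+1) : i <= n by rewrite -ltnS.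
have le_b (i : 'I_n.+1) : block_cycle alpha i <= n.
  by have := @block_cycle_lt alpha i; rewrite sum_a => /(_ (ltn_ord i)).
rewrite !sigmaE // (stair_letter_ltE (j := j)) ?ltn_eqF //.
rewrite stair_letter_ltE //; first by case: eqP.
apply: contraTneq lt_jk => eq_b.
have := sigmaE sum_a (le_n j); rewrite eq_b -sigmaE // => /perm_inj/stair_letter_inj ->.
- by rewrite ltnn.
- exact: le_n.
- exact: le_n.
Qed.

Lemma sum_odd_half a : \sum_(j < a) odd j = a./2.
Proof.
elim: a => [|a IH]; first by rewrite big_ord0.
by rewrite big_ord_recr /= IH uphalf_half addnC.
Qed.

(** In the first block, a position other than the last goes to its successor. This flips its parity,
    so it is inverted with every later position that is not the last of the block. Only pairs
    containing the last position, which goes to 0, remain: inside the block those with odd [j]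
    count, and across blocks all or none, according to the parity of [a]. *)
Lemma stair_ascents_cons a alpha :
  stair_ascents (a :: alpha) = a.-1./2 + odd a * sumn alpha + stair_ascents alpha.
Proof.
set tau := block_cycle (a :: alpha).
have tauS j : j.+1 < a -> tau j = j.+1 by rewrite /tau /= => lt_ja; rewrite ltnW // ltn_eqF.
have tauD j : tau (a + j) = a + block_cycle alpha j.
  by rewrite /tau /= ltnNge leq_addr addKn.
have tau_last : 0 < a -> tau a.-1 = 0 by move=> a0; rewrite /tau /= prednK // leqnn eqxx.
rewrite /stair_ascents -/tau [sumn (a :: alpha)]/= big_split_ord /= -addnA; congr (_ + _).
  case: a tau tauS tauD tau_last => [|a] tau tauS _ tau_last; first by rewrite big_ord0.
  have /= tau_a := tau_last isT.
  rewrite big_ord_recr /= big1 ?add0n => [|k _].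
    rewrite -sum_odd_half; apply: eq_bigr => j _.
    by rewrite tau_a tauS ?ltnS // /stair_lt ltn_ord /=; case: odd.
  rewrite big1 // => j _; have lt_jk := ltn_ord j; have lt_ka := ltn_ord k.
  by rewrite !tauS ?ltnS 1?(ltn_trans lt_jk) // /stair_lt ltnS lt_jk /=; case: odd.
have -> : (odd a * sumn alpha = \sum_(k < sumn alpha) odd a)%N.
  by rewrite sum_nat_const card_ord mulnC.
rewrite -big_split; apply: eq_bigr => k _ /=; rewrite big_split_ord /=; congr (_ + _).
  case: a tau tauS tauD tau_last => [|a] tau tauS tauD tau_last; first by rewrite big_ord0.
  have /= tau_a := tau_last isT.
  rewrite big_ord_recr /= big1 ?add0n => [|j _].
    by rewrite tau_a tauD /stair_lt addSn ltnS leq_addr /=; case: odd.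
  rewrite tauS ?ltnS // tauD /stair_lt.
  have lt_ja := ltn_ord j.
  by rewrite !ifT /=; [case: odd | lia | lia].
(* Shifting by an odd [a] negates both comparisons, by an even [a] neither. *)
apply: eq_bigr => j _; rewrite !tauD /stair_lt !ltn_add2l !oddD.
by case: (odd a); do 2!case: ifP => _; do 2!case: odd.
Qed.

End LengthOfSigma.

(** * Maximal compositions minimize the number of ascents *)

Section MaximalCompositions.
Implicit Types alpha beta l : seq nat.

(* A composition is maximal iff it is sorted for this total preorder, in which
   all even parts are equivalent. *)
Definition block_order a b := ~~ odd a || odd b && (b <= a).

Lemma block_order_trans : transitive block_order.
Proof. by move=> b a c; rewrite /block_order; do 3!case: odd => //=; lia. Qed.

(** In a sorted list an odd part is followed by odd parts only. *)
Lemma sorted_block_order_split alpha :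
    sorted block_order alpha ->
  alpha = [seq a <- alpha | ~~ odd a] ++ [seq a <- alpha | odd a].
Proof.
elim: alpha => //= a alpha IH; rewrite (path_sortedE block_order_trans).
case/andP => /allP le_a /IH def_alpha; have [odd_a /= | /= _] := boolP (odd a); last first.
  by rewrite -def_alpha.
have all_odd : all odd alpha.
  by apply/allP => b /le_a; rewrite /block_order odd_a => /andP[].
rewrite (all_filterP all_odd); suff /eqP-> : [seq b <- alpha | ~~ odd b] == [::] by [].
by rewrite -[_ == _]negbK -has_filter -all_predC; apply: sub_all all_odd => b /= ->.
Qed.

Lemma sorted_odd_geq alpha :
  sorted block_order alpha -> sorted geq [seq a <- alpha | odd a].
Proof.
move=> /(sorted_filter block_order_trans odd) sorted_odd.
apply: sub_in_sorted (filter_all odd _) sorted_odd.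
by move=> a b odd_a _; rewrite /block_order [odd a]odd_a => /andP[].
Qed.

Lemma is_max_compE n alpha :
  is_max_comp n alpha = is_comp n alpha && sorted block_order alpha.
Proof.
rewrite /is_max_comp; case: is_comp => //=; apply/existsP/idP => [[k]|sorted_a].
  case/and3P=> even_t odd_d sorted_d; rewrite -(cat_take_drop k alpha).
  elim: (take _ _) even_t => [_|a l IH /andP[even_a /IH]] /=.
    apply: sub_in_sorted odd_d sorted_d => a b _ odd_b ge_ab.
    by rewrite /block_order [odd b]odd_b [b <= a]ge_ab orbT.
  by case: (l ++ _) => //= b l'; rewrite /block_order even_a.
have def_a := sorted_block_order_split sorted_a.
have lt_k : size [seq a <- alpha | ~~ odd a] < (size alpha).+1.
  by rewrite ltnS size_filter count_size.
exists (Ordinal lt_k); rewrite [alpha in take _ alpha]def_a [alpha in drop _ alpha]def_a /=.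
by rewrite take_size_cat // drop_size_cat // !filter_all sorted_odd_geq.
Qed.

(** Only the cross term of the two parts sees their order: [odd a * b] against [odd b * a]. Each is
    added on the opposite side to avoid subtraction. *)
Lemma stair_ascents_swap l a b l' :
  stair_ascents (l ++ a :: b :: l') + odd b * a
    = stair_ascents (l ++ b :: a :: l') + odd a * b.
Proof.
elim: l => [|c l IH] /=; rewrite !stair_ascents_cons ?sumn_cat /=.
  by case: odd; case: odd; lia.
by rewrite -!addnA !(addnC (stair_ascents _)) in IH *; lia.
Qed.

Lemma stair_ascents_even_cat l l' : all (predC odd) l ->
  stair_ascents (l ++ l') = \sum_(a <- l) a.-1./2 + stair_ascents l'.
Proof.
elim: l => [|a l IH] /=; first by rewrite big_nil.
case/andP=> /negPf even_a /IH eq_l.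
by rewrite stair_ascents_cons even_a big_cons eq_l addn0 addnA.
Qed.

Lemma perm_sorted_odd alpha beta :
    perm_eq alpha beta -> sorted block_order alpha -> sorted block_order beta ->
  [seq a <- alpha | odd a] = [seq a <- beta | odd a].
Proof.
move=> eq_ab sorted_a sorted_b; apply: (@sorted_eq _ geq).
- by move=> b a c /= ba cb; apply: leq_trans ba.
- by move=> a b; rewrite andbC -eqn_leq => /eqP.
- exact: sorted_odd_geq.
- exact: sorted_odd_geq.
- exact: perm_filter.
Qed.

(** Leading even parts contribute no cross terms, so their order is irrelevant; the odd parts come
    in decreasing order, fixed by the multiset. *)
Lemma perm_stair_ascents alpha beta :
    perm_eq alpha beta -> sorted block_order alpha -> sorted block_order beta ->
  stair_ascents alpha = stair_ascents beta.
Proof.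
move=> eq_ab sorted_a sorted_b.
rewrite (sorted_block_order_split sorted_a) (sorted_block_order_split sorted_b).
rewrite !stair_ascents_even_cat ?filter_all // (perm_sorted_odd eq_ab) //; congr (_ + _).
by apply: perm_big; apply: perm_filter.
Qed.

Lemma unsorted_swap alpha :
    ~~ sorted block_order alpha ->
  exists l a b l', alpha = l ++ a :: b :: l' /\ ~~ block_order a b.
Proof.
elim: alpha => //= a [|b alpha] IH //=; rewrite negb_and => /orP[nab|].
  by exists [::], a, b, alpha.
by case/IH=> l [c [d [l' [-> ncd]]]]; exists (a :: l), c, d, l'.
Qed.

(** A bad adjacent pair has [a] odd and [b] even or larger than [a]; swapping it saves [b] ascents
    in the first case and [b - a] in the second. *)
Lemma sorted_block_order_min alpha :
    all (leq 1) alpha ->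
    (forall beta, perm_eq alpha beta -> stair_ascents alpha <= stair_ascents beta) ->
  sorted block_order alpha.
Proof.
move=> pos_a min_a; apply: contraT => /unsorted_swap[l [a [b [l' [def_a]]]]].
rewrite /block_order negb_or negbK negb_and -ltnNge => /andP[odd_a b_a].
have eq_ab : perm_eq alpha (l ++ b :: a :: l').
  by rewrite def_a perm_cat2l; apply/permPl/(perm_catCA [:: a] [:: b]).
have := stair_ascents_swap l a b l'; have := min_a _ eq_ab.
have [pos_ia pos_ib] : 0 < a /\ 0 < b.
  by move: pos_a; rewrite def_a all_cat /= => /and4P[].
by rewrite -def_a odd_a; case: (odd b) b_a => /= b_a; lia.
Qed.

End MaximalCompositions.

(** * Rearranged compositions give conjugate elements *)

Section Conjugacy.

Lemma perm_shape (T : eqType) (cs : seq (seq T)) (beta : seq nat) :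
  perm_eq (shape cs) beta -> exists2 cs', perm_eq cs cs' & shape cs' = beta.
Proof.
rewrite perm_sym => /(perm_iotaP 0)[i_s]; rewrite size_map => eq_is def_b.
exists [seq nth [::] cs i | i <- i_s].
  rewrite -{1}[cs](mkseq_nth [::]) perm_sym; exact: perm_map.
rewrite def_b /shape -map_comp; apply/eq_in_map => i; rewrite (perm_mem eq_is).
by rewrite mem_iota => /andP[_ lt_i] /=; rewrite (nth_map [::]).
Qed.

Lemma uniq_perm_map (T : finType) (s t : seq T) :
    uniq s -> uniq t -> s =i T -> t =i T -> size s = size t ->
  exists g : {perm T}, map g t = s.
Proof.
case: s => [|x0 s'].
  by move=> _ _ _ _; case: t => // _; exists 1.
set s := x0 :: s' => Us Ut s_T t_T eq_size.
have gI : injective (fun x => nth x0 s (index x t)).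
  move=> x y /eqP; rewrite nth_uniq // ?eq_size ?index_mem ?t_T // => /eqP eq_i.
  by rewrite -(nth_index x0 (t_T x)) eq_i nth_index ?t_T.
exists (perm gI); apply: (@eq_from_nth _ x0) => [|i]; rewrite size_map // => lt_i.
by rewrite (nth_map x0) // permE index_uniq.
Qed.

(** Reorder the cycles of [sigma_alpha] so that their lengths read [beta]; the relabelling [g] of
    the concatenated cycles into the stair conjugates one element to the other. *)
Lemma sigma_conj n alpha beta : perm_eq alpha beta -> sumn alpha = n.+1 ->
  exists g, sigma n.+1 beta = sigma n.+1 alpha ^ g.
Proof.
move=> eq_ab sum_a; set s := stair n.+1; set cs := reshape alpha s.
have flat_cs : flatten cs = s by rewrite reshapeKr // size_stair sum_a.
have shape_cs : shape cs = alpha by rewrite reshapeKl // size_stair sum_a.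
have [|cs' eq_cs shape_cs'] := @perm_shape _ cs beta; first by rewrite shape_cs.
have eq_flat := perm_flatten eq_cs; rewrite flat_cs in eq_flat.
have Ucs : uniq (flatten cs) by rewrite flat_cs stair_uniq.
have Ucs' : uniq (flatten cs') by rewrite -(perm_uniq eq_flat) stair_uniq.
have [|||g def_s] := uniq_perm_map (stair_uniq n) Ucs'.
- by move=> x; rewrite mem_stair.
- by move=> x; rewrite -(perm_mem eq_flat) mem_stair.
- exact: perm_size.
exists g; rewrite /sigma -/cs (eq_cycle_prod Ucs eq_cs) cycle_prodJ //.
by rewrite -[stair _]def_s -shape_cs' -map_reshape flattenK.
Qed.

End Conjugacy.

(** * Recovering the composition *)

Section CycleType.

Lemma order_conj (T : finType) (w g : {perm T}) x :
  fingraph.order (w ^ g) (g x) = fingraph.order w x.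
Proof.
have Uorb : uniq (map g (fingraph.orbit w x)).
  by rewrite map_inj_uniq ?fingraph.orbit_uniq //; apply: perm_inj.
rewrite (order_cycle (p := map g (fingraph.orbit w x))) ?size_map ?size_orbit //;
  last by rewrite map_f ?fingraph.in_orbit.
rewrite cycle_map; apply: sub_cycle (cycle_orbit (@perm_inj _ w) x).
by move=> y z /= /eqP <-; rewrite permJ.
Qed.

Lemma order_cycle_prod (T : finType) (cs : seq (seq T)) c x :
    uniq (flatten cs) -> c \in cs -> x \in c ->
  fingraph.order (\prod_(c <- cs) cycle_perm c) x = size c.
Proof.
move=> Ucs c_cs xc; apply: (order_cycle (p := c)) => //; last exact: flatten_uniq c_cs.
apply: (cycle_from_next (flatten_uniq Ucs c_cs)) => y yc.
by apply/eqP; apply: cycle_prodE.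
Qed.

Lemma count_order_cycle_prod (T : finType) (cs : seq (seq T)) m :
    uniq (flatten cs) ->
  count [pred x | fingraph.order (\prod_(c <- cs) cycle_perm c) x == m] (flatten cs)
    = (m * count_mem m (shape cs))%N.
Proof.
move=> Ucs; set P := [pred x | _].
have cntP c : c \in cs -> count P c = if size c == m then m else 0%N.
  move=> c_cs; rewrite (eq_in_count (a2 := fun=> size c == m)) => [|x xc].
    by case: eqP => [<-|_]; [apply: count_predT | apply: count_pred0].
  by rewrite /= (order_cycle_prod Ucs c_cs).
rewrite count_flatten; move: P cntP => P {Ucs}; elim: cs => [|c cs' IH] cntP /=.
  by rewrite muln0.
rewrite mulnDr IH => [|c' c'_cs]; last by rewrite cntP // inE c'_cs orbT.
by rewrite cntP ?mem_head //; case: eqP; rewrite ?muln1 ?muln0.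
Qed.

Lemma card_order_sigma n alpha m : sumn alpha = n.+1 ->
  #|[set x | fingraph.order (sigma n.+1 alpha) x == m]| = (m * count_mem m alpha)%N.
Proof.
move=> sum_a; have flat_s : flatten (reshape alpha (stair n.+1)) = stair n.+1.
  by rewrite reshapeKr // size_stair sum_a.
have := @count_order_cycle_prod _ (reshape alpha (stair n.+1)) m.
rewrite flat_s reshapeKl ?size_stair ?sum_a // => <-; last exact: stair_uniq.
rewrite cardsE cardE /enum_mem size_filter -enumT.
apply/seq.permP; apply: uniq_perm; rewrite ?enum_uniq ?stair_uniq // => x.
by rewrite mem_enum mem_stair.
Qed.

(** The number of points in orbits of size [m] is invariant under conjugation and equals [m] times
    the multiplicity of [m]; parts being positive, [m] cancels. *)
Lemma conj_sigma_perm n alpha beta g :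
    is_comp n.+1 alpha -> is_comp n.+1 beta -> sigma n.+1 beta = sigma n.+1 alpha ^ g ->
  perm_eq alpha beta.
Proof.
case/andP=> /allP pos_a /eqP sum_a /andP[/allP pos_b /eqP sum_b] conj_ab.
apply/allP => m m_ab; have pos_m : 0 < m.
  by move: m_ab; rewrite mem_cat => /orP[/pos_a | /pos_b].
rewrite /= -(eqn_pmul2l pos_m) -!(card_order_sigma _ (n := n)) // conj_ab.
rewrite eq_sym -(card_preimset _ (@perm_inj _ g)); apply/eqP/eq_card => x.
by rewrite !inE order_conj.
Qed.

End CycleType.

(* These k record the partial sums of the leading even parts of alpha when
   w = sigma n alpha, and they do not change along length-preserving steps. *)
Definition swaps_ends n k (w : 'S_n) : Prop :=
  k.*2 <= n /\ forall i : 'I_n, (i < k) = (n - k <= w i) /\ (n - k <= i) = (w i < k).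

(** The property can only be affected when [s] moves a letter across a border, that is, [j = k] or
    [j = n - k]. There the exchange of the ends makes both [v] and its inverse descend, so a step
    that keeps the length fixes [v]. *)
Lemma swaps_ends_step n k (v w : 'S_n) :
    cyc_step v w -> perm_length v = perm_length w -> swaps_ends k v -> swaps_ends k w.
Proof.
case/existsP=> i /existsP[j /and3P[/eqP ij /eqP-> _]] eq_len [le_k2n endsv].
set s := tperm i j in eq_len *.
have endsV p : (v^-1 p < k) = (n - k <= p) /\ (n - k <= v^-1 p) = (p < k).
  by have [] := endsv (v^-1 p); rewrite permKV.
have descent : v j < v i -> v^-1 j < v^-1 i -> swaps_ends k (s * v * s).
  move=> vij vVij; have [] := perm_length_conj_descent ij vij vVij; last by move->.
  by rewrite eq_len ltnn.
have [jk | nejk] := eqVneq (j : nat) k.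
  have [vi1 vi2] := endsv i; have [vj1 vj2] := endsv j.
  have [Vi1 Vi2] := endsV i; have [Vj1 Vj2] := endsV j.
  by apply: descent; lia.
have [jnk | nejnk] := eqVneq (j : nat) (n - k).
  have [vi1 vi2] := endsv i; have [vj1 vj2] := endsv j.
  have [Vi1 Vi2] := endsV i; have [Vj1 Vj2] := endsV j.
  by apply: descent; lia.
have sk p : (s p < k) = (p < k) by rewrite (tperm_adjE ij); do !case: eqP; lia.
have snk p : (n - k <= s p) = (n - k <= p) by rewrite (tperm_adjE ij); do !case: eqP; lia.
by split=> // p; rewrite !permM !sk !snk -(sk p) -(snk p).
Qed.

(** [swaps_ends] read on positions: the [k] smallest letters sit at the even positions below [k.*2],
    the [k] largest at the odd ones. *)
Definition block_swaps_ends (alpha : seq nat) k : Prop :=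
  k.*2 <= sumn alpha /\ forall j, j < sumn alpha ->
    let j' := block_cycle alpha j in
    (~~ odd j && (j < k.*2)) = (odd j' && (j' < k.*2)) /\
    (odd j && (j < k.*2)) = (~~ odd j' && (j' < k.*2)).

Lemma swaps_ends_sigma n alpha k : sumn alpha = n.+1 ->
  swaps_ends k (sigma n.+1 alpha) <-> block_swaps_ends alpha k.
Proof.
move=> sum_a; rewrite /swaps_ends /block_swaps_ends sum_a.
have lowX j : j <= n -> k.*2 <= n.+1 -> (stair_letter n j < k) = (~~ odd j && (j < k.*2)).
  by move=> le_jn le_k; rewrite stair_letterE //; case: ifP => odd_j /=; lia.
have highX j : j <= n -> k.*2 <= n.+1 ->
      (n.+1 - k <= stair_letter n j) = (odd j && (j < k.*2)).
  by move=> le_jn le_k; rewrite stair_letterE //; case: ifP => odd_j /=; lia.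
have le_b j : j <= n -> block_cycle alpha j <= n.
  by move=> le_jn; rewrite -ltnS -sum_a block_cycle_lt // sum_a.
split=> -[le_k ends]; split=> //; [move=> j | move=> p].
  by rewrite ltnS => le_jn /=; rewrite -!lowX ?le_b // -!highX ?le_b // -sigmaE //.
have [j le_jn ->] := stair_letterP p; rewrite sigmaE // !lowX ?le_b // !highX ?le_b //.
exact: ends.
Qed.

Lemma block_swaps_ends0 alpha : block_swaps_ends alpha 0.
Proof. by split=> // j _ /=; rewrite !andbF. Qed.

(** A block of even length alternates parities, including at its wrap-around from an odd position to
    0, and the shift by [a] preserves parity. *)
Lemma block_swaps_ends_even a alpha k : ~~ odd a ->
  block_swaps_ends (a :: alpha) (a./2 + k) <-> block_swaps_ends alpha k.
Proof.
move=> even_a; have a2 : (a./2 + k).*2 = a + k.*2 by lia.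
rewrite /block_swaps_ends a2 /= leq_add2l; split=> -[le_k ends]; split=> // j lt_j.
  have [] := ends (a + j); first by rewrite ltn_add2l.
  by rewrite [a + j < a]ltnNge leq_addr /= addKn !ltn_add2l !oddD (negPf even_a).
have [lt_ja|le_aj] := ltnP j a; last first.
  have [] := ends (j - a); first lia.
  have -> : odd j = odd (j - a) by rewrite oddB // (negPf even_a) addbF.
  have -> : (j < a + k.*2) = (j - a < k.*2) by lia.
  by rewrite ltn_add2l oddD (negPf even_a).
by case: eqP => ja /=; split; lia.
Qed.

(** If [k.*2 < a], position [k.*2.-1] leaves the range; if [a] is odd, the even last position of the
    block goes to the even position 0. *)
Lemma block_swaps_ends_cons a alpha k : 0 < a -> 0 < k ->
  block_swaps_ends (a :: alpha) k -> ~~ odd a /\ a <= k.*2.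
Proof.
move=> a_gt0 k_gt0 [/= le_k ends].
have le_ak : a <= k.*2.
  rewrite leqNgt; apply/negP => lt_ka.
  have [|_] := ends k.*2.-1; first lia.
  by rewrite ifT ?ifF; lia.
split=> //; apply/negP => odd_a.
have [|+ _] := ends a.-1; first lia.
by rewrite prednK // leqnn eqxx /=; lia.
Qed.

(** A leading even part is twice the least positive admissible [k], hence common to both lists and
    removable. Once a list starts with an odd part all its parts are odd, and the multiset
    determines it. *)
Lemma block_swaps_ends_inj alpha beta :
    all (leq 1) alpha -> all (leq 1) beta ->
    sorted block_order alpha -> sorted block_order beta -> perm_eq alpha beta ->
    (forall k, block_swaps_ends alpha k <-> block_swaps_ends beta k) ->
  alpha = beta.
Proof.
elim: alpha beta => [|a alpha IH] [|b beta] //; try by move=> _ _ _ _ /perm_size.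
move=> pos_a pos_b sorted_a sorted_b eq_ab ends_ab.
have [a_gt0 pos_alpha] := andP pos_a; have [b_gt0 pos_beta] := andP pos_b.
have even_le c d gamma delta : 0 < c -> 0 < d -> ~~ odd c ->
    (forall k, block_swaps_ends (c :: gamma) k <-> block_swaps_ends (d :: delta) k) ->
  ~~ odd d /\ d <= c.
  move=> c_gt0 d_gt0 even_c ends_cd.
  have := (ends_cd c./2).1; rewrite -[X in block_swaps_ends _ X]addn0.
  rewrite block_swaps_ends_even // => /(_ (block_swaps_ends0 _)).
  by move=> /block_swaps_ends_cons; rewrite even_halfK //; apply=> //; lia.
have [odd_a|even_a] := boolP (odd a); last first.
  have [even_b le_ba] := even_le _ _ _ _ a_gt0 b_gt0 even_a ends_ab.
  have [_ le_ab] := even_le _ _ _ _ b_gt0 a_gt0 even_b (fun k => iff_sym (ends_ab k)).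
  have eq_ba : b = a by apply/eqP; rewrite eqn_leq le_ba.
  subst b; rewrite perm_cons in eq_ab; congr cons.
  apply: IH => //; [exact: path_sorted sorted_a | exact: path_sorted sorted_b | move=> k].
  by rewrite -(block_swaps_ends_even alpha k even_a) -(block_swaps_ends_even beta k even_a).
have [odd_b|even_b] := boolP (odd b); last first.
  have [] := even_le _ _ _ _ b_gt0 a_gt0 even_b (fun k => iff_sym (ends_ab k)).
  by rewrite odd_a.
have all_odd c gamma : odd c -> sorted block_order (c :: gamma) -> all odd (c :: gamma).
  move=> odd_c /=; rewrite odd_c (path_sortedE block_order_trans) => /andP[/allP le_c _].
  by apply/allP => d /le_c; rewrite /block_order odd_c => /andP[].
have := perm_sorted_odd eq_ab sorted_a sorted_b.
by rewrite !(all_filterP (all_odd _ _ _ _)).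
Qed.

(** * Equivalence classes of maximal elements *)

Section ApproxClasses.
Variable n : nat.
Implicit Types v w : 'S_n.

Lemma connect_length v w : connect (@cyc_step n) v w -> perm_length w <= perm_length v.
Proof.
case/connectP=> p; elim: p v => [|u p IH] v /=; first by move=> _ ->.
case/andP=> /existsP[i /existsP[j /and3P[_ _ le_uv]]] path_p def_w.
exact: leq_trans (IH u path_p def_w) le_uv.
Qed.

Lemma connect_class v w : connect (@cyc_step n) v w -> w \in v ^: [set: 'S_n].
Proof.
case/connectP=> p; elim: p v => [|u p IH] v /=; first by move=> _ ->; apply: class_refl.
case/andP=> /existsP[i /existsP[j /and3P[_ /eqP def_u _]]] path_p def_w.
suff /class_eqP <- : u \in v ^: [set: 'S_n] by apply: IH.
by apply/imsetP; exists (tperm i j); rewrite ?inE // def_u conjgE tpermV mulgA.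
Qed.

Lemma Smax_max v w :
  w \in Smax n -> v \in w ^: [set: 'S_n] -> perm_length v <= perm_length w.
Proof. by rewrite inE => /forall_inP; apply. Qed.

Lemma Smax_class v w :
    w \in Smax n -> v \in w ^: [set: 'S_n] -> perm_length w <= perm_length v ->
  v \in Smax n.
Proof.
move=> w_max vw le_wv; rewrite inE; apply/forall_inP => u.
rewrite (class_eqP vw) => uw; exact: leq_trans (Smax_max w_max uw) le_wv.
Qed.

(** Lengths never increase along the path and its end has maximal length in the class, so every
    element on it is maximal and every step can be reversed. *)
Lemma connect_Smax v w :
  connect (@cyc_step n) v w -> w \in Smax n -> v \in Smax n /\ approx v w.
Proof.
move=> con_vw w_max; have le_wv := connect_length con_vw.
have v_max : v \in Smax n.
  by apply: Smax_class w_max _ le_wv; rewrite class_sym connect_class.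
split=> //; rewrite /approx con_vw /=.
case/connectP: con_vw => p; elim: p v v_max {le_wv} => [|u p IH] v v_max /=.
  by move=> _ ->.
case/andP=> step_vu path_p def_w.
have con_uw : connect (@cyc_step n) u w by apply/connectP; exists p.
have con_vu := connect1 step_vu.
have u_max : u \in Smax n.
  apply: Smax_class w_max _ (connect_length con_uw).
  by rewrite class_sym connect_class.
apply: connect_trans (IH u u_max path_p def_w) (connect1 _).
case/existsP: step_vu => i /existsP[j /and3P[ij /eqP def_u _]].
apply/existsP; exists i; apply/existsP; exists j; rewrite ij /=.
rewrite def_u !mulgA tperm2 mul1g -mulgA tperm2 mulg1 eqxx /= -def_u.
by apply: Smax_max u_max _; rewrite class_sym connect_class.
Qed.

Lemma approx_Smax v w : approx v w -> v \in Smax n -> w \in Smax n.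
Proof. by case/andP=> _ /connect_Smax/[apply]-[]. Qed.

Lemma approx_refl : reflexive (@approx n).
Proof. by move=> w; rewrite /approx connect0. Qed.

Lemma approx_sym : symmetric (@approx n).
Proof. by move=> v w; rewrite /approx andbC. Qed.

Lemma approx_trans : transitive (@approx n).
Proof.
move=> u v w /andP[vu uv] /andP[uw wu].
by rewrite /approx (connect_trans vu uw) (connect_trans wu uv).
Qed.

Lemma approx_equivalence : {in Smax n & &, equivalence_rel (@approx n)}.
Proof.
move=> u v w _ _ _; split=> [|uv]; first exact: approx_refl.
apply/idP/idP; apply: approx_trans; last by [].
by rewrite approx_sym.
Qed.

(** Both ends of the path have the same length, so each step preserves length. *)
Lemma approx_swaps_ends k v w : approx v w -> swaps_ends k v -> swaps_ends k w.
Proof.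
case/andP=> con_vw /connect_length le_vw.
case/connectP: con_vw => p; elim: p v le_vw => [|u p IH] v le_vw /=; first by move=> _ ->.
case/andP=> step_vu path_p def_w ends_v.
have con_uw : connect (@cyc_step n) u w by apply/connectP; exists p.
have le_uv := connect_length (connect1 step_vu).
have le_wu := connect_length con_uw.
apply: (IH u) => //; first exact: leq_trans le_uv le_vw.
apply: swaps_ends_step step_vu _ ends_v; apply/eqP; rewrite eqn_leq le_uv andbT.
exact: leq_trans le_wu.
Qed.

End ApproxClasses.

(** * Stair forms as representatives of the classes *)

Section Sigma.
Variable n : nat.
Implicit Types (w : 'S_n.+1) (alpha beta : seq nat).

(** The stair form above [w] is again maximal. Rearrangements of [alpha] give conjugates, none of
    them longer, so [alpha] has fewest ascents among them. *)
Lemma Smax_approx_sigma w : w \in Smax n.+1 ->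
  exists2 alpha, is_max_comp n.+1 alpha & approx (sigma n.+1 alpha) w.
Proof.
move=> w_max; have [alpha comp_a con_a] := connect_sigma w.
have [s_max s_w] := connect_Smax con_a w_max; exists alpha => //.
rewrite is_max_compE comp_a; have /andP[pos_a /eqP sum_a] := comp_a.
apply: sorted_block_order_min => // beta eq_ab.
have [g def_b] := sigma_conj eq_ab sum_a.
have le_s : perm_length (sigma n.+1 beta) <= perm_length (sigma n.+1 alpha).
  by apply: Smax_max => //; rewrite def_b; apply: memJ_class; rewrite inE.
have sum_b : sumn beta = n.+1 by rewrite -(perm_sumn eq_ab).
have := perm_length_sigma sum_a; rewrite -(perm_length_sigma sum_b) => eq_l.
by rewrite -(leq_add2l (perm_length (sigma n.+1 alpha))) eq_l leq_add2r.
Qed.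

(** A longest conjugate is equivalent to some [sigma_beta] with [beta] maximal. Equal cycle types
    make [beta] a rearrangement of [alpha], and two sorted rearrangements have the same number of
    ascents. *)
Lemma sigma_Smax alpha : is_max_comp n.+1 alpha -> sigma n.+1 alpha \in Smax n.+1.
Proof.
rewrite is_max_compE => /andP[comp_a sorted_a].
have s_refl := class_refl [set: 'S_n.+1] (sigma n.+1 alpha).
have [w w_s max_w] := arg_maxnP (@perm_length n.+1) s_refl.
have w_max : w \in Smax n.+1.
  by rewrite inE; apply/forall_inP => u; rewrite (class_eqP w_s); apply: max_w.
have [beta] := Smax_approx_sigma w_max; rewrite is_max_compE => /andP[comp_b sorted_b].
case/andP=> con_bw _; have [b_max _] := connect_Smax con_bw w_max.
have s_b : sigma n.+1 alpha \in sigma n.+1 beta ^: [set: 'S_n.+1].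
  by rewrite -(class_eqP (connect_class con_bw)) class_sym.
have [g _ def_s] := imsetP s_b.
have eq_ba := conj_sigma_perm comp_b comp_a def_s.
apply: Smax_class b_max s_b _.
have [_ /eqP sum_a] := andP comp_a; have [_ /eqP sum_b] := andP comp_b.
rewrite -(leq_add2r (stair_ascents beta)) perm_length_sigma //.
by rewrite (perm_stair_ascents eq_ba) // perm_length_sigma.
Qed.

(** Conjugacy gives the multiset of parts, and the invariant [swaps_ends] gives the order of the
    even ones. *)
Lemma approx_sigma_inj alpha beta :
    is_max_comp n.+1 alpha -> is_max_comp n.+1 beta ->
    approx (sigma n.+1 alpha) (sigma n.+1 beta) ->
  alpha = beta.
Proof.
rewrite !is_max_compE => /andP[comp_a sorted_a] /andP[comp_b sorted_b] ab.
have /andP[/connect_class/imsetP[g _ conj_ab] _] := ab.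
have eq_ab := conj_sigma_perm comp_a comp_b conj_ab.
have [pos_a /eqP sum_a] := andP comp_a; have [pos_b /eqP sum_b] := andP comp_b.
apply: block_swaps_ends_inj => // k.
rewrite -!(swaps_ends_sigma _ (n := n)) //.
by split; apply: approx_swaps_ends => //; rewrite approx_sym.
Qed.

Lemma SigmaE alpha : is_max_comp n.+1 alpha ->
  Sigma n.+1 alpha = [set w in Smax n.+1 | approx (sigma n.+1 alpha) w].
Proof.
move=> max_a; apply/setP => w; rewrite [LHS]inE [RHS]inE.
by case ap: approx; rewrite ?andbF // (approx_Smax ap (sigma_Smax max_a)).
Qed.

Lemma Sigma_in_quotient alpha :
  is_max_comp n.+1 alpha -> Sigma n.+1 alpha \in Smax_quotient n.+1.
Proof.
move=> max_a; rewrite SigmaE //; apply/imsetP.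
by exists (sigma n.+1 alpha); rewrite ?sigma_Smax.
Qed.

Lemma quotient_Sigma C : C \in Smax_quotient n.+1 ->
  exists2 alpha, is_max_comp n.+1 alpha & C = Sigma n.+1 alpha.
Proof.
case/imsetP=> w w_max ->; have [alpha max_a aw] := Smax_approx_sigma w_max.
exists alpha => //; rewrite SigmaE //; apply/setP => v; rewrite !inE; congr (_ && _).
apply/idP/idP; apply: approx_trans => //; by rewrite approx_sym.
Qed.

End Sigma.

Local Open Scope classical_set_scope.

Theorem theorem3p5 (n : nat) (hn : (0 < n)%N) :
  set_bij [set alpha : seq nat | is_max_comp n alpha]
          [set C : {set 'S_n} | C \in Smax_quotient n]
          (Sigma n)
  /\ is_transversal (stair_reps n) (Smax_quotient n) (Smax n).
Proof.
case: n hn => // n _; split.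
  split=> [alpha max_a | alpha beta | C /quotient_Sigma[alpha max_a ->]].
  - exact: Sigma_in_quotient.
  - move=> /set_mem max_a /set_mem max_b eq_ab; apply: (approx_sigma_inj max_a max_b).
    have : sigma n.+1 beta \in Sigma n.+1 beta by rewrite inE approx_refl.
    by rewrite -eq_ab inE.
  - by exists alpha.
apply/and3P; split.
- exact: equivalence_partitionP (@approx_equivalence n.+1).
- by apply/fintype.subsetP => w; rewrite inE => /asboolP[alpha max_a ->]; apply: sigma_Smax.
apply/forall_inP => C /quotient_Sigma[alpha max_a ->].
apply/cards1P; exists (sigma n.+1 alpha); apply/setP => w; rewrite !inE.
apply/andP/eqP => [[/asboolP[beta max_b ->] ab] | ->].
  by rewrite (approx_sigma_inj max_a max_b ab).
by split; [apply/asboolP; exists alpha | apply: approx_refl].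
Qed.
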